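(* Let $\alpha=\frac{1+\sqrt5}{2}$ and $\beta=\frac{1-\sqrt5}{2}$. For every positive integer $n$, $$\sigma_1(P_n)=\frac15\left[(n-1)\left(\alpha^n+\beta^n\right)+\frac{2}{\sqrt5}\left(\alpha^{n-1}-\beta^{n-1}\right)\right].$$
   Context: $P_n$ is the path graph on $n$ vertices. For a finite simple undirected graph $G$, $\sigma_1(G)$ denotes the number of $1$-nearly independent vertex subsets of $G$, i.e. the number of subsets $I$ of the vertex set $V(G)$ such that the subgraph of $G$ induced by $I$ has exactly one edge. *)

(* Defs.v *)
From mathcomp Require Import all_boot.

Set Implicit Arguments.
Unset Strict Implicit.
Unset Printing Implicit Defensive.

Record sgraph := SGraph {
  vertex :> finType;
  adj : rel vertex;
  adj_sym : symmetric adj;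
  adj_irr : irreflexive adj
}.

(* An edge is the unordered pair of its endpoints, so each is counted once. *)
Definition edges (G : sgraph) : {set {set G}} :=
  [set [set x; y] | x in G, y in G & adj x y].

Section Induced.
Variables (G : sgraph) (I : {set G}).

Definition induced_adj : rel {x : G | x \in I} :=
  fun x y => adj (val x) (val y).

Lemma induced_adj_sym : symmetric induced_adj.
Proof. by move=> x y; apply: adj_sym. Qed.

Lemma induced_adj_irr : irreflexive induced_adj.
Proof. by move=> x; apply: adj_irr. Qed.

Definition induced : sgraph := SGraph induced_adj_sym induced_adj_irr.

End Induced.

Definition sigma1 (G : sgraph) : nat :=
  #|[set I : {set G} | #|edges (induced I)| == 1]|.

Section Path.
Variable n : nat.

Definition path_adj : rel 'I_n := fun i j => (i.+1 == j) || (j.+1 == i).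

Lemma path_adj_sym : symmetric path_adj.
Proof. by move=> i j; rewrite /path_adj orbC. Qed.

Lemma path_adj_irr : irreflexive path_adj.
Proof. by move=> i; rewrite /path_adj orbb gtn_eqF. Qed.

Definition path_graph : sgraph := SGraph path_adj_sym path_adj_irr.

End Path.

(* Main.v *)
(** Encode a vertex subset of the path as its bit string: induced edges become
    pairs of consecutive ones.  Prepending a bit [h] to the strings gives, for
    the numbers of strings with zero or one such pair, a linear recursion
    governed by the Fibonacci recurrence, which the Binet-type expressions
    solve. *)

Require Import Defs.
From HB Require Import structures.
From mathcomp Require Import all_boot all_order all_algebra.
From mathcomp Require Import zify ring.

Set Implicit Arguments.
Unset Strict Implicit.
Unset Printing Implicit Defensive.

Import Order.TTheory GRing.Theory Num.Theory.

(* No bound [i.+1 < size s] is needed, since [nth] defaults to [false]. *)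
Definition ones_pairs (s : seq bool) : nat :=
  \sum_(i < size s) (nth false s i && nth false s i.+1).

Lemma ones_pairs_cons (h : bool) (s : seq bool) :
  ones_pairs (h :: s) = (h && head false s) + ones_pairs s.
Proof. by rewrite /ones_pairs big_ord_recl /= nth0. Qed.

Definition set_of_bits (n : nat) (t : n.-tuple bool) : {set 'I_n} :=
  [set i | tnth t i].

Lemma set_of_bits_bij (n : nat) : bijective (@set_of_bits n).
Proof.
exists (fun I : {set 'I_n} => [tuple i \in I | i < n]) => [t | I].
  by apply: eq_from_tnth => i; rewrite tnth_mktuple inE.
by apply/setP => i; rewrite inE tnth_mktuple.
Qed.

(** An edge of the path is determined by its smaller endpoint [i], so [F] matches the positions [i]
    in [D] with the induced edges. *)
Lemma card_edges_induced_path (n : nat) (t : n.-tuple bool) :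
  #|edges (@induced (path_graph n) (set_of_bits t))| = ones_pairs t.
Proof.
set G := induced _.
have inI (x : G) : nth false t (val x : 'I_n).
  by move: (valP x); rewrite inE (tnth_nth false).
(* The default [false] makes a true bit force [k < n]; so [i.+1] is a vertex for each [i] in [D]. *)
have vertexP (k : nat) : nth false t k -> exists x : G, (val x : 'I_n) = k :> nat.
  move=> tk; have lt_kn : k < n.
    by rewrite ltnNge; apply/negP => le_nk; rewrite nth_default ?size_tuple in tk.
  have kI : Ordinal lt_kn \in set_of_bits t by rewrite inE (tnth_nth false).
  by exists (Sub (Ordinal lt_kn) kI).
pose D := [set i : 'I_n | nth false t i && nth false t i.+1].
(* Comparing values in [nat] makes [F] total, with no membership proofs for [i] and [i.+1]. *)
pose F (i : 'I_n) : {set G} :=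
  [set x : G | ((val x : 'I_n) == i :> nat) || ((val x : 'I_n) == i.+1 :> nat)].
have val_nat_inj (x y : G) : (val x : 'I_n) = (val y : 'I_n) :> nat -> x = y.
  by move=> exy; apply/val_inj/val_inj.
have FE (x y : G) : (val x : 'I_n).+1 = (val y : 'I_n) ->
    [set x; y] = F (val x).
  move=> exy; apply/setP => z; rewrite !inE exy.
  by congr (_ || _); apply/eqP/eqP => [-> // | /val_nat_inj].
have -> : edges G = F @: D.
  apply/setP => e; apply/imset2P/imsetP => [[x y _] | [i]].
    rewrite inE => /andP[_ /orP[]/eqP exy] ->.
      by exists (val x); [rewrite inE inI exy inI | rewrite FE].
    by exists (val y); [rewrite inE inI exy inI | rewrite setUC FE].
  rewrite inE => /andP[/vertexP[x xi] /vertexP[y yi]] ->.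
  have exy : (val x : 'I_n).+1 = (val y : 'I_n) by rewrite xi yi.
  exists x y => //; first by rewrite inE /= /induced_adj /= /path_adj exy eqxx.
  by rewrite FE //; congr F; apply: val_inj.
(* Injectivity: [F i = F j] puts [i] in {j, j+1} and [j] in {i, i+1}, hence [i = j]. *)
rewrite card_in_imset => [|i j]; last first.
  rewrite !inE => /andP[/vertexP[x xi] _] /andP[/vertexP[y yj] _] eF.
  have : x \in F j by rewrite -eF inE xi eqxx.
  have : y \in F i by rewrite eF inE yj eqxx.
  by rewrite !inE xi yj => ? ?; apply: val_inj => /=; lia.
by rewrite cardsE -sum1_card big_mkcond /ones_pairs size_tuple.
Qed.

(** The extra bit [h] is the state of the recursion; [h = false] creates no pair and so gives the
    plain count. *)
Definition count_strings (k : nat) (h : bool) (n : nat) : nat :=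
  \sum_(t : n.-tuple bool) (ones_pairs (h :: t) == k).

Lemma sigma1_path (n : nat) : sigma1 (path_graph n) = count_strings 1 false n.
Proof.
rewrite /sigma1 -sum1dep_card big_mkcond /=.
rewrite (reindex _ (onW_bij _ (set_of_bits_bij n))) /=.
apply: eq_bigr => t _.
by rewrite card_edges_induced_path ones_pairs_cons; case: (_ == _).
Qed.

Lemma sum_tuple_cons (T : finType) (n : nat) (f : seq T -> nat) :
  \sum_(t : n.+1.-tuple T) f t = \sum_(b : T) \sum_(t : n.-tuple T) f (b :: t).
Proof.
rewrite pair_big /=.
rewrite (reindex (fun p : T * n.-tuple T => [tuple of p.1 :: p.2])) //=.
exists (fun t => (thead t, [tuple of behead t])) => [[b t] _ | t _] /=.
  by congr pair; apply: val_inj.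
by rewrite [t in RHS]tuple_eta; apply: val_inj.
Qed.

Lemma count_strings0 (k : nat) (h : bool) : count_strings k h 0 = (k == 0).
Proof.
rewrite /count_strings (big_pred1 [tuple]) => [|t].
  by rewrite ones_pairs_cons /ones_pairs big_ord0 andbF eq_sym.
by rewrite /= [t]tuple0; apply/esym/eqP/val_inj.
Qed.

(** Split on the first bit of the string: a one after [h = true] uses up one pair. The [if] guards
    the truncated subtraction at [k = 0]. *)
Lemma count_stringsS (k : nat) (h : bool) (n : nat) :
  count_strings k h n.+1 =
  (if h && (k == 0) then 0 else count_strings (k - h) true n)
  + count_strings k false n.
Proof.
rewrite /count_strings (sum_tuple_cons n (fun s => ones_pairs (h :: s) == k : nat)).
rewrite big_bool /=; congr (_ + _); last first.
  by apply: eq_bigr => t _; rewrite ones_pairs_cons andbF.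
case: ifP => [/andP[-> /eqP->] | hk].
  by rewrite big1 // => t _; rewrite ones_pairs_cons.
apply: eq_bigr => t _; rewrite ones_pairs_cons andbT.
by congr nat_of_bool; case: h hk => /= hk; lia.
Qed.

Local Open Scope ring_scope.

(* With [a = alpha ^+ n] and [b = beta ^+ n]: the counts with no pair of ones
   are [F_(n+2)] and [F_(n+1)], and in the last two [F_(n-1)] is written as
   [F_(n+1) - F_n] so that the identities hold from [n = 0] on. *)
Lemma count_strings_closed_form (R : fieldType) (s alpha beta : R) (n : nat) :
  s ^+ 2 = 5 -> (2 : R) != 0 -> (5 : R) != 0 ->
  alpha = (1 + s) / 2 -> beta = (1 - s) / 2 ->
  let a := alpha ^+ n in let b := beta ^+ n in
  [/\ (count_strings 0 false n)%:R = s / 5 * (alpha ^+ 2 * a - beta ^+ 2 * b),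
      (count_strings 0 true n)%:R = s / 5 * (alpha * a - beta * b),
      (count_strings 1 false n)%:R = 1 / 5 * ((n%:R - 1) * (a + b) +
        2 * (s / 5) * ((alpha - 1) * a - (beta - 1) * b))
    & (count_strings 1 true n)%:R = 1 / 5 * (n%:R * (alpha * a + beta * b) -
        (n%:R - 1) * (a + b) +
        2 * (s / 5) * ((2 - alpha) * a - (2 - beta) * b))].
Proof.
move=> s2 two_neq0 five_neq0 alphaE betaE.
have alpha2 : alpha ^+ 2 = alpha + 1 by rewrite alphaE; field: s2.
(* With everything in terms of [alpha], the single relation [alpha2] is enough for [field]. *)
have {s2 alphaE betaE} [-> ->] : s = 2 * alpha - 1 /\ beta = 1 - alpha.
  by rewrite alphaE betaE; split; field.
elim: n => [|n].
  by rewrite !count_strings0 /=; split; field: alpha2.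
rewrite !count_stringsS /= !exprS !natrD -[n.+1]addn1 natrD.
by move=> /= [-> -> -> ->]; split; field: alpha2.
Qed.

Theorem mainTheorem8 (R : rcfType) (n : nat) (n_gt0 : (0 < n)%N) :
  let alpha : R := (1 + Num.sqrt 5) / 2 in
  let beta : R := (1 - Num.sqrt 5) / 2 in
  (sigma1 (path_graph n))%:R =
    1 / 5 * ((n%:R - 1) * (alpha ^+ n + beta ^+ n) +
             2 / Num.sqrt 5 * (alpha ^+ (n - 1) - beta ^+ (n - 1))).
Proof.
move=> alpha beta.
have s2 : Num.sqrt 5 ^+ 2 = 5 :> R by rewrite sqr_sqrtr ?ler0n.
have s_neq0 : Num.sqrt 5 != 0 :> R by rewrite -sqrf_eq0 s2 pnatr_eq0.
have alpha2 : alpha ^+ 2 = alpha + 1 by rewrite /alpha; field: s2.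
have betaE : beta = 1 - alpha by rewrite /beta /alpha; field.
have sE : Num.sqrt 5 = 2 * alpha - 1 :> R by rewrite /alpha; field.
have two_neq0 : (2 : R) != 0 by rewrite pnatr_eq0.
have five_neq0 : (5 : R) != 0 by rewrite pnatr_eq0.
have [_ _ F1 _] := count_strings_closed_form n s2 two_neq0 five_neq0 erefl erefl.
(* Both roots satisfy x(x - 1) = 1, which turns [(alpha - 1) * alpha ^+ n] into [alpha ^+ (n - 1)],
   and likewise for [beta]. *)
rewrite sigma1_path F1 -/alpha -/beta -(prednK n_gt0) subn1 /= !exprS.
have -> : 2 / Num.sqrt 5 = 2 * (Num.sqrt 5 / 5) :> R by field: s2.
by rewrite sE betaE; field: alpha2.
Qed.
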